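(* Let $G$ be a cyclically $4$-edge-connected cubic graph. Let $C$ be a $2$-factor of $G$ containing exactly two odd circuits $N_1$ and $N_2$ (and possibly some even circuits). Let $e=x_1x_2$ be an edge of $G$ with $x_1\in V(N_1)$ and $x_2\in V(N_2)$. Let $F=G-E(C)$ (the perfect matching complementary to $C$) and let $M$ be a maximum matching in $C-\{x_1,x_2\}$. For $i\in\{1,2\}$ let $Z_i$ be the set of edges of $N_i$ that are not incident with $x_i$ but are incident with a neighbour of $x_i$ on $N_i$. Suppose there exist a smooth orientation of the circuits of the subgraph with edge set $(E(F)\setminus\{e\})\cup M$ and a smooth orientation of $C$ which agree on all edges of $Z_1\cup Z_2$. Then $fn(G)=2$.
   Context: A circuit is a connected $2$-regular graph; a cycle is a graph in which every vertex has even degree. A graph is cyclically $k$-edge-connected if the removal of fewer than $k$ edges cannot separate it into two components that both contain a cycle. A smooth orientation of a set of edge-disjoint circuits is an orientation in which, for every circuit of the set, each vertex of that circuit has exactly one incoming and one outgoing edge of that circuit. An orientation is strong if for every ordered pair of distinct vertices $u,v$ there is a directed $uv$-path. An edge $e$ is deletable in an orientation $(G,o)$ if the restriction of $o$ to $E(G)\setminus\{e\}$ is a strong orientation of $G-e$. For a $3$-edge-connected graph $G$, the Frank number $fn(G)$ is the minimum number $k$ such that $G$ admits $k$ orientations with the property that every edge of $G$ is deletable in at least one of them. *)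

(* Defs.v *)
From mathcomp Require Import all_boot.
Set Implicit Arguments. Unset Strict Implicit. Unset Printing Implicit Defensive.

(* A (simple, finite) graph is given by a symmetric irreflexive relation
   g : rel T on a finite vertex type T.  Edges are 2-element vertex sets. *)

Section Graphs.
Variable T : finType.

Definition edges (g : rel T) : {set {set T}} :=
  [set f : {set T} | [exists u, exists v, g u v && (f == [set u; v])]].

Definition adj_of (S : {set {set T}}) : rel T :=
  fun u v => (u != v) && ([set u; v] \in S).

Definition cubic (g : rel T) : Prop := forall v, #|[set u | g v u]| = 3.

Definition has_cycle_in (S : {set {set T}}) (X : {set T}) : Prop :=
  exists c : seq T, [/\ 3 <= size c, uniq c, cycle (adj_of S) c & all (mem X) c].

Definition component (S : {set {set T}}) (v : T) : {set T} :=
  [set w | connect (adj_of S) v w].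

Definition cyclically_k_edge_connected (g : rel T) (k : nat) : Prop :=
  forall S : {set {set T}}, S \subset edges g -> #|S| < k ->
    ~ (exists u w, [/\ component (edges g :\: S) u != component (edges g :\: S) w,
                       has_cycle_in (edges g :\: S) (component (edges g :\: S) u) &
                       has_cycle_in (edges g :\: S) (component (edges g :\: S) w)]).

Definition two_factor (g : rel T) (C : {set {set T}}) : Prop :=
  C \subset edges g /\ forall v, #|[set f in C | v \in f]| = 2.

(* the circuits of a 2-factor C are its connected components *)
Definition circuit_of (C : {set {set T}}) (N : {set T}) : Prop :=
  exists v, N = component C v.

Definition matching_in (S M : {set {set T}}) : Prop :=
  M \subset S /\ forall f f', f \in M -> f' \in M -> f != f' -> [disjoint f & f'].

Definition maximum_matching_in (S M : {set {set T}}) : Prop :=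
  matching_in S M /\ forall M', matching_in S M' -> #|M'| <= #|M|.

Definition orientation_of (S : {set {set T}}) (D : rel T) : Prop :=
  (forall u v, D u v -> adj_of S u v) /\
  (forall u v, adj_of S u v -> D u v != D v u).

Definition circuit_edges (S : {set {set T}}) : {set {set T}} :=
  [set f in S | [exists u, exists v,
     (f == [set u; v]) && (u != v) && connect (adj_of (S :\ f)) u v]].

(* smooth orientation of the circuits of the subgraph with edge set S
   (used for subgraphs of maximum degree 2, whose circuits are
   vertex-disjoint): every circuit edge is oriented, and every vertex of a
   circuit has exactly one incoming and one outgoing circuit edge *)
Definition smooth_orientation_circuits (S : {set {set T}}) (D : rel T) : Prop :=
  orientation_of (circuit_edges S) D /\
  forall v, (exists2 f, f \in circuit_edges S & v \in f) ->
    #|[set w | D w v]| = 1 /\ #|[set w | D v w]| = 1.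

Definition strong_orientation (S : {set {set T}}) (D : rel T) : Prop :=
  orientation_of S D /\ forall u v, u != v -> connect D u v.

Definition deletable (g : rel T) (D : rel T) (e : {set T}) : Prop :=
  strong_orientation (edges g :\ e) (fun u v => D u v && ([set u; v] != e)).

Definition frank_good (g : rel T) (k : nat) : Prop :=
  exists os : 'I_k -> rel T,
    (forall i, orientation_of (edges g) (os i)) /\
    forall e, e \in edges g -> exists i, deletable g (os i) e.

Definition frank_number_is (g : rel T) (n : nat) : Prop :=
  frank_good g n /\ forall k, k < n -> ~ frank_good g k.

End Graphs.

(* Main.v *)
(* Smooth orientations are circulations, so [D1 + 2 D2] and
   [2 D1 - D2] are flows on G - e; orient every edge along them, and e from x1
   to x2 in both orientations. If an arc a is not deletable, it is the only arc
   leaving some vertex set X, so its value is the total value entering X, and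
   the cut of X has at least 3 edges; since G is cyclically 4-edge-connected, a
   cut of size 3 isolates a vertex. Hence an arc of value 1 is deletable unless
   the cut is {a, e, b} around x1 or x2, that is, unless a enters x1 or leaves
   x2. Every edge other than e has value 1 in one of the two flows; an edge of C
   that enters x1 or leaves x2 in the second one has value 2 in the first one and
   is reversed there. It could then only be the sum of two arcs of value 1 at its
   other end p, which is impossible: the matching edge at p lies in Z1 or Z2, so
   D1 and D2 agree on it and it has value 3. *)
Require Import Defs.
From mathcomp Require Import all_boot.
From mathcomp Require Import zify.
Set Implicit Arguments. Unset Strict Implicit. Unset Printing Implicit Defensive.

(** * Edges as vertex pairs, degrees and bridges *)

Lemma set2_eqP (T : finType) (u v a b : T) :
  [set u; v] = [set a; b] -> (u = a /\ v = b) \/ (u = b /\ v = a).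
Proof.
move=> E.
have := set21 u v; have := set22 u v; rewrite E !inE.
have := set21 a b; have := set22 a b; rewrite -E !inE.
by do 4![case/orP=> /eqP ?]; subst; auto.
Qed.

Lemma mem_edges (T : finType) (g : rel T) (g_sym : symmetric g) u v :
  ([set u; v] \in edges g) = g u v.
Proof.
rewrite inE; apply/existsP/idP => [[a /existsP[b /andP[gab /eqP/set2_eqP]]]|guv].
  by case=> -[-> ->] //; rewrite g_sym.
by exists u; apply/existsP; exists v; rewrite guv eqxx.
Qed.

Lemma adj_of_sym (T : finType) (S : {set {set T}}) : symmetric (adj_of S).
Proof. by move=> u v; rewrite /adj_of eq_sym setUC. Qed.

Lemma card_adj_of (T : finType) (g : rel T) (S : {set {set T}}) (v : T)
    (g_irr : irreflexive g) (sS : S \subset edges g) :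
  #|[set w | adj_of S v w]| = #|[set f in S | v \in f]|.
Proof.
rewrite -[LHS](@card_in_imset _ _ (fun w => [set v; w])); last first.
  move=> w w'; rewrite !inE => /andP[vw _] /andP[vw' _] /set2_eqP[[]|[E]] //.
  by rewrite E eqxx in vw'.
apply: eq_card => f; rewrite inE; apply/imsetP/andP.
  by case=> w; rewrite inE => /andP[_ wS] ->; rewrite set21.
case=> fS vf; have := subsetP sS f fS; rewrite inE.
case/existsP=> a /existsP[b /andP[gab /eqP E]].
have ab : a != b by apply: contraTneq gab => ->; rewrite g_irr.
move: vf; rewrite E !inE => /orP[] /eqP Ev; subst v.
  by exists b => //; rewrite inE /adj_of ab -E.
by exists a; rewrite 1?setUC // inE /adj_of eq_sym ab setUC -E.
Qed.

(** Comparing ranks sorts edge ends into lower and upper ones; each edge has one of each, so the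
    total is twice the number of edges. *)
Lemma handshake (T : finType) (e : rel T) : symmetric e -> irreflexive e ->
  ~~ odd (\sum_x #|[set y | e x y]|).
Proof.
move=> es ei; pose lt (x y : T) := enum_rank x < enum_rank y.
have -> : \sum_x #|[set y | e x y]| =
    \sum_x \sum_y (e x y && lt x y) + \sum_x \sum_y (e x y && lt y x).
  rewrite -big_split; apply: eq_bigr => x _; rewrite -big_split /=.
  rewrite -sum1dep_card big_mkcond; apply: eq_bigr => y _.
  case exy: (e x y) => //=; rewrite /lt; case: ltngtP => //.
  by move=> /ord_inj/enum_rank_inj xy; rewrite xy ei in exy.
rewrite [X in _ + X]exchange_big /= [X in _ + X](eq_bigr (fun x => \sum_y (e x y && lt x y))).
  by rewrite addnn odd_double.
by move=> x _; apply: eq_bigr => y _; rewrite es.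
Qed.

(* Handshake: otherwise the side of the bridge would have exactly one vertex
   of odd degree. *)
Lemma even_no_bridge (T : finType) (S : {set {set T}})
    (S2 : forall f, f \in S -> exists u, exists2 v, u != v & f = [set u; v])
    (evenS : forall v, ~~ odd #|[set w | adj_of S v w]|) :
  circuit_edges S = S.
Proof.
apply/setP=> f; rewrite inE; case fS: (f \in S) => //=.
have [u [v uv fE]] := S2 f fS.
apply/existsP; exists u; apply/existsP; exists v.
rewrite -fE eqxx uv /=; apply/negPn/negP=> nuv.
set r := adj_of (S :\ f); pose X := [set w | connect r u w].
have uX : u \in X by rewrite inE connect0.
have vX : v \notin X by rewrite inE.
have rs : symmetric r by apply: adj_of_sym.
have cl x y : r x y -> (x \in X) = (y \in X).
  move=> xy; rewrite !inE; apply/idP/idP => ux; apply: connect_trans ux (connect1 _) => //.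
  by rewrite rs.
(* Inside [X], the edges of [S] other than [f] give every vertex its degree in [S], except that [u]
   loses [f]. *)
pose e' x y := r x y && (x \in X).
have e's : symmetric e'.
  by move=> x y; rewrite /e' rs; case yx: (r y x) => //=; rewrite (cl y x).
have e'i : irreflexive e' by move=> x; rewrite /e' /r /adj_of eqxx.
have := handshake e's e'i.
have -> : \sum_x #|[set y | e' x y]| = \sum_(x in X) #|[set y | r x y]|.
  rewrite [RHS]big_mkcond; apply: eq_bigr => x _; rewrite /e'.
  by case: (x \in X); [apply: eq_card => y | apply: eq_card0 => y]; rewrite !inE (andbT, andbF).
have rE x y : r x y = adj_of S x y && ([set x; y] != f).
  by rewrite /r /adj_of !inE; do 3![case: (_ == _) || case: (_ \in _)].
rewrite (big_setD1 u) //=.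
have -> : #|[set y | r u y]| = #|[set y | adj_of S u y]|.-1.
  rewrite [in RHS](cardsD1 v) inE {1}/adj_of uv -fE fS /=.
  apply: eq_card => y; rewrite !inE rE andbC; congr (_ && _).
  rewrite fE; congr (~~ _); apply/eqP/eqP => [/set2_eqP[[]|[E]]|->] //.
  by rewrite E eqxx in uv.
have u0 : 0 < #|[set y | adj_of S u y]|.
  by apply/card_gt0P; exists v; rewrite inE /adj_of uv -fE fS.
have -> : \sum_(i in X :\ u) #|[set y | r i y]| = \sum_(i in X :\ u) #|[set y | adj_of S i y]|.
  apply: eq_bigr => x; rewrite !inE => /andP[xu ux]; apply: eq_card => y.
  rewrite !inE rE; case: eqP; rewrite ?andbT // fE => /set2_eqP[][E _].
    by rewrite E eqxx in xu.
  by move: vX; rewrite -E inE ux.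
have /negbTE : ~~ odd (\sum_(i in X :\ u) #|[set y | adj_of S i y]|).
  by elim/big_ind: _ => // a b /negbTE oa /negbTE ob; rewrite oddD oa ob.
rewrite oddD => ->; have := evenS u.
by case: #|_| u0 => //= n _; rewrite addbF => /negbNE->.
Qed.

(** * Small cuts *)

(** The first vertex of a longest path in [Y] has all its neighbours in [Y] on the path; one of them
    is not the second vertex and closes a cycle. *)
Lemma min_degree2_cycle (T : finType) (r : rel T) (Y : {set T}) (x0 : T) :
  symmetric r -> irreflexive r -> x0 \in Y ->
  (forall v, v \in Y -> 1 < #|[set u in Y | r v u]|) ->
  exists c, [/\ 3 <= size c, uniq c, cycle r c & all (mem Y) c].
Proof.
move=> rs ri x0Y deg.
pose P n := [exists t : n.+1.-tuple T,
  [&& uniq t, path r (head x0 t) (behead t) & all (mem Y) t]].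
have P0 : exists n, P n.
  exists 0; apply/existsP; exists [tuple x0].
  by rewrite /= andbT.
have Pb n : P n -> n <= #|T|.
  case/existsP=> t /and3P[ut _ _].
  have := card_uniqP ut; rewrite size_tuple => /= tE.
  by apply: ltnW; rewrite -tE max_card.
case: (ex_maxnP P0 Pb) => n /existsP[t] /[swap] nmax.
case: t => -[//|x p] /= sp.
case/and3P=> /andP[xp up] xrp /andP[xY pY].
have nbr z : z \in Y -> r x z -> z \in p.
  move=> zY xz; apply: contraT => zp.
  have zx : z != x by apply: contraTneq xz => ->; rewrite ri.
  suff /nmax : P n.+1 by rewrite ltnn.
  have st : size [:: z, x & p] == n.+2 by rewrite /= (eqP sp).
  apply/existsP; exists (Tuple st).
  by rewrite /= !inE negb_or zx zp xp up rs xz xrp zY xY pY.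
have [y [yY xy yh]] : exists y, [/\ y \in Y, r x y & y != head x p].
  have : 0 < #|[set u in Y | r x u] :\ head x p|.
    by have := deg x xY; rewrite (cardsD1 (head x p)); case: (_ \in _) => /=; lia.
  by case/card_gt0P=> y; rewrite !inE => /and3P[? ? ?]; exists y.
have yp := nbr y yY xy.
move: xrp xp up pY yh sp {nbr}; case/splitPr: yp => p1 p2.
rewrite cat_path -cat_rcons mem_cat cat_uniq all_cat.
case/and3P=> xp1 rp1 _; rewrite negb_or => /andP[xp _] /andP[up _] /andP[pY _] yh _.
exists (x :: rcons p1 y); split.
- by case: p1 yh {xp1 rp1 xp up pY} => [|a p1] /=; rewrite ?eqxx // size_rcons.
- by rewrite /= xp up.
- by rewrite /= !rcons_path xp1 rp1 last_rcons rs xy.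
- by rewrite /= xY pY.
Qed.

(** Deleting a vertex of degree at most 1 lowers the degree sum by at most 2 and twice the order by
    exactly 2, so the inequality survives; it also rules out a lone vertex. When no such vertex is
    left, [min_degree2_cycle] applies. *)
Lemma dense_cycle (T : finType) (r : rel T) (X : {set T}) :
  symmetric r -> irreflexive r -> X != set0 ->
  #|X|.*2 <= \sum_(v in X) #|[set u in X | r v u]| ->
  exists c, [/\ 3 <= size c, uniq c, cycle r c & all (mem X) c].
Proof.
move=> rs ri.
have [n] := ubnP #|X|; elim: n X => // n IH X Xn X0 dX.
have [/existsP[v /andP[vX dv]]|] := boolP [exists v in X, #|[set u in X | r v u]| <= 1]; last first.
  move/existsPn=> deg; have [x0 x0X] := set0Pn _ X0.
  apply: (min_degree2_cycle rs ri x0X) => v vX.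
  by have := deg v; rewrite vX /= -ltnNge.
have XE u : u \in X -> #|[set w in X | r u w]| = #|[set w in X :\ v | r u w]| + r v u.
  move=> uX; rewrite (cardsD1 v) !inE vX /= addnC rs; congr (_ + _).
  by apply: eq_card => w; rewrite !inE andbA.
have [c [c3 uc cc cX]] : exists c, [/\ 3 <= size c, uniq c, cycle r c & all (mem (X :\ v)) c].
  have X1 : #|X| = #|X :\ v|.+1 by rewrite (cardsD1 v) vX.
  have : #|X :\ v|.*2 <= \sum_(u in X :\ v) #|[set w in X :\ v | r u w]|.
    move: dX; rewrite (big_setD1 v) //=.
    rewrite (eq_bigr (fun u => #|[set w in X :\ v | r u w]| + r v u)); last first.
      by move=> u; rewrite !inE => /andP[_ uX]; rewrite XE.
    rewrite big_split /=.
    have -> : \sum_(i in X :\ v) r v i = #|[set u in X | r v u]|.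
      rewrite -sum1dep_card big_mkcond [RHS]big_mkcond; apply: eq_bigr => i _.
      rewrite !inE; have [->|_] := eqVneq i v; first by rewrite ri andbF.
      by case: (i \in X).
    by move: dv; rewrite X1; lia.
  apply: IH; first by lia.
  apply/eqP=> E; move: dX; rewrite (big_setD1 v) //= E big_set0; lia.
exists c; split=> //; apply: sub_all cX => w.
by rewrite /= !inE => /andP[].
Qed.

(** Pairs pointing out of [X]: each cut edge is listed once, and its direction can be compared with
    that of the flow. *)
Definition cut (T : finType) (g : rel T) (X : {set T}) : {set T * T} :=
  [set p | [&& p.1 \in X, p.2 \notin X & g p.1 p.2]].

Section Cuts.
Variables (T : finType) (g : rel T).
Hypotheses (g_sym : symmetric g) (g_irr : irreflexive g) (g_cubic : cubic g).
Implicit Types X : {set T}.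

Lemma card_cutC X : #|cut g (~: X)| = #|cut g X|.
Proof.
have swapI : injective (fun p : T * T => (p.2, p.1)) by move=> [a b] [c d] [-> ->].
rewrite -[LHS](card_imset _ swapI).
apply: eq_card => -[a b]; apply/imsetP/idP => [[[u v]]|].
  by rewrite !inE /= negbK g_sym => /and3P[? ? ?] [-> ->]; apply/and3P.
rewrite inE /= => /and3P[? ? ?]; exists (b, a) => //.
by rewrite !inE /= negbK g_sym; apply/and3P.
Qed.

Lemma degree_sum_cut X :
  \sum_(v in X) #|[set u in X | g v u]| + #|cut g X| = 3 * #|X|.
Proof.
have -> : #|cut g X| = \sum_(v in X) #|[set u in ~: X | g v u]|.
  rewrite -sum1dep_card (eq_bigr (fun v => \sum_(u | (u \notin X) && g v u) 1)).
    by rewrite pair_big_dep.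
  by move=> v _; rewrite -sum1dep_card; apply: eq_bigl => u; rewrite !inE.
rewrite -big_split /= mulnC -sum_nat_const; apply: eq_bigr => v _.
rewrite -(g_cubic v) -[RHS](cardsID X); congr (_ + _); apply: eq_card => u; rewrite !inE //.
  by rewrite andbC.
Qed.

(** The degree sum inside [X] is three times the order minus the cut size, hence at least twice the
    order once there are 3 vertices. Two vertices have inner degree sum at most 2 and would leave at
    least 4 cut edges. *)
Lemma small_cut_cycle X : 1 < #|X| -> #|cut g X| <= 3 ->
  exists c, [/\ 3 <= size c, uniq c, cycle g c & all (mem X) c].
Proof.
move=> X1 c3; apply: dense_cycle => //.
  by rewrite -card_gt0; lia.
have := degree_sum_cut X; have [X3|] := leqP 3 #|X|; first by lia.
move=> X2; have {X1 X2}XE : #|X| = 2 by lia.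
suff : \sum_(v in X) #|[set u in X | g v u]| <= \sum_(v in X) 1.
  by rewrite sum1_card; lia.
apply: leq_sum => v vX; rewrite -ltnS -XE [#|X|](cardsD1 v) vX ltnS.
by apply/subset_leq_card/subsetP=> u; rewrite !inE; case: eqP => [->|]; rewrite ?g_irr ?andbF // => _ /andP[].
Qed.

Hypothesis g_c4 : cyclically_k_edge_connected g 4.

(** With two vertices on each side, [small_cut_cycle] gives a cycle on each side, and deleting the
    at most 3 cut edges separates them. *)
Lemma small_cut_trivial X : #|cut g X| <= 3 -> #|X| <= 1 \/ #|~: X| <= 1.
Proof.
move=> c3; have [X1|X1] := leqP #|X| 1; first by left.
have [Y1|Y1] := leqP #|~: X| 1; first by right.
have [c [sc uc cc cX]] := small_cut_cycle X1 c3.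
have [d [sd ud cd dX]] : exists c, [/\ 3 <= size c, uniq c, cycle g c & all (mem (~: X)) c].
  by apply: small_cut_cycle => //; rewrite card_cutC.
pose S := (fun p : T * T => [set p.1; p.2]) @: cut g X.
have sS : S \subset edges g.
  by apply/subsetP=> f /imsetP[p]; rewrite inE => /and3P[_ _ ?] ->; rewrite mem_edges.
have S4 : #|S| < 4 by apply: leq_ltn_trans (leq_imset_card _ _) _.
have adjS u v : adj_of (edges g :\: S) u v = g u v && ((u \in X) == (v \in X)).
  rewrite /adj_of inE mem_edges //.
  have [guv|] := boolP (g u v); last by rewrite !andbF.
  have -> /= : u != v by apply: contraTneq guv => ->; rewrite g_irr.
  rewrite andbT; apply/idP/idP => [|/eqP uv]; last first.
    apply/imsetP=> -[[a b]].
    rewrite inE /= => /and3P[aX bX _] /set2_eqP[] [E E'].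
      by move: aX bX; rewrite -E -E' uv => ->.
    by move: aX bX; rewrite -E -E' uv => ->.
  apply: contraR => uv; apply/imsetP.
  have [uX|uX] := boolP (u \in X).
    by exists (u, v); rewrite // inE /= uX guv andbT; move: uv; rewrite uX.
  by exists (v, u); rewrite 1?setUC // inE /= uX g_sym guv andbT; move: uv; rewrite (negbTE uX); case: (_ \in _).
have cyc (b : bool) s : all (fun x => (x \in X) == b) s -> cycle g s ->
    cycle (adj_of (edges g :\: S)) s.
  move=> sX; apply: (sub_in_cycle (P := fun x => (x \in X) == b)) sX => x y.
  by rewrite -!topredE /= adjS => /eqP-> /eqP-> ->; rewrite eqxx.
have comp x s : cycle (adj_of (edges g :\: S)) (x :: s) -> 3 <= size (x :: s) -> uniq (x :: s) ->
    has_cycle_in (edges g :\: S) (component (edges g :\: S) x).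
  move=> cs ss us; exists (x :: s); split=> //; apply/allP=> y ys.
  rewrite /= inE; move: cs => /=; rewrite rcons_path => /andP[xs _].
  exact: (path_connect xs).
case: c sc uc cc cX => // x c sc uc cc cX.
case: d sd ud cd dX => // y d sd ud cd dX.
case: (g_c4 sS S4); exists x, y; split; last 2 first.
- apply: (comp x c) => //; apply: (cyc true) => //; by apply: sub_all cX => z /= ->.
- apply: (comp y d) => //; apply: (cyc false) => //; by apply: sub_all dX => z /=; rewrite inE => /negbTE->.
apply/eqP=> E; have : y \in component (edges g :\: S) x by rewrite E inE connect0.
rewrite inE => /(closed_connect (a := mem X)) H.
have xX : x \in X by case/andP: cX.
have yX : y \notin X by case/andP: dX; rewrite /= inE.
move: yX; rewrite -[y \in X]H ?xX // => u v.
by rewrite adjS => /andP[_ /eqP].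
Qed.

(** A smaller cut would isolate a vertex by [small_cut_trivial], and in a cubic graph such a cut has
    3 edges. *)
Lemma cut_ge3 X : X != set0 -> ~: X != set0 -> 3 <= #|cut g X|.
Proof.
have triv Y : Y != set0 -> #|Y| <= 1 -> #|cut g Y| = 3.
  rewrite -card_gt0 => Y0 Y1; have /cards1P[v ->] : #|Y| == 1 by lia.
  have := degree_sum_cut [set v]; rewrite big_set1 cards1.
  suff -> : [set u in [set v] | g v u] = set0 by rewrite cards0.
  by apply/setP=> u; rewrite !inE; case: eqP => // ->; rewrite g_irr.
move=> X0 Y0; rewrite leqNgt; apply/negP=> c2.
have [X1|X1] := small_cut_trivial (ltnW c2).
  by rewrite triv in c2.
by rewrite -card_cutC triv in c2.
Qed.

Lemma cut3_singleton X : X != set0 -> ~: X != set0 -> #|cut g X| <= 3 ->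
  (exists v, X = [set v]) \/ (exists v, ~: X = [set v]).
Proof.
rewrite -!card_gt0 => X0 Y0 /small_cut_trivial[] ?; [left|right];
  by apply/cards1P; lia.
Qed.
End Cuts.

(** * Flows and deletable arcs *)

Definition balanced (T : finType) (f : T -> T -> nat) : Prop :=
  forall v, \sum_w f v w = \sum_w f w v.

(** Truncated subtraction keeps the surplus in its own direction and puts 0 on the reverse arc, so
    the flow also determines an orientation. *)
Definition net (T : finType) (f : T -> T -> nat) : T -> T -> nat :=
  fun u v => f u v - f v u.

Lemma balanced_net (T : finType) (f : T -> T -> nat) : balanced f -> balanced (net f).
Proof.
(* Both [net f v w + f w v] and [net f w v + f v w] equal the maximum of the two values, which deals
   with the truncation. *)
move=> bf v; apply/(@addIn (\sum_w f w v)).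
rewrite -[in RHS]bf -!big_split; apply: eq_bigr => w _ /=; rewrite /net; lia.
Qed.

(** When the balance is summed over [X], the flow between vertices of [X] appears on both sides and
    cancels. *)
Lemma balanced_cut (T : finType) (f : T -> T -> nat) (X : {set T}) : balanced f ->
  \sum_(p | (p.1 \in X) && (p.2 \notin X)) f p.1 p.2 =
  \sum_(p | (p.1 \in X) && (p.2 \notin X)) f p.2 p.1.
Proof.
move=> bf.
have : \sum_(v in X) \sum_w f v w = \sum_(v in X) \sum_w f w v.
  by apply: eq_bigr.
rewrite (eq_bigr (fun v => \sum_(w in X) f v w + \sum_(w | w \notin X) f v w)); last first.
  by move=> v _; rewrite (bigID (mem X)).
rewrite [RHS](eq_bigr (fun v => \sum_(w in X) f w v + \sum_(w | w \notin X) f w v)); last first.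
  by move=> v _; rewrite (bigID (mem X)).
rewrite !big_split /= [X in _ = X + _]exchange_big /= => /addnI.
by rewrite !pair_big_dep.
Qed.

Lemma not_connect_closed (T : finType) (D : rel T) u v : ~~ connect D u v ->
  exists X : {set T}, [/\ u \in X, v \notin X & forall a b, a \in X -> D a b -> b \in X].
Proof.
move=> nuv; exists [set w | connect D u w]; split; rewrite ?inE ?connect0 //.
by move=> a b; rewrite !inE => ua ab; apply: connect_trans ua (connect1 ab).
Qed.

Section DeletableArcs.
Variables (T : finType) (g : rel T) (x1 x2 : T) (f : T -> T -> nat).
Hypotheses (g_sym : symmetric g) (g_irr : irreflexive g) (g_cubic : cubic g).
Hypothesis (g_c4 : cyclically_k_edge_connected g 4).
Hypotheses (he : g x1 x2) (bf : balanced f).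
Hypothesis f_anti : forall u v, 0 < f u v -> f v u = 0.
Hypothesis f_supp : forall u v,
  (0 < f u v) || (0 < f v u) = g u v && ([set u; v] != [set x1; x2]).

(** By [f_supp] the edge between [x1] and [x2] carries no flow, so its direction is set by hand. *)
Definition flow_orientation : rel T :=
  fun u v => (0 < f u v) || ((u == x1) && (v == x2)).

Local Notation o := flow_orientation.

Lemma flow_e : f x1 x2 = 0 /\ f x2 x1 = 0.
Proof. by have := f_supp x1 x2; rewrite eqxx andbF; case: (f x1 x2) (f x2 x1) => [|?] []. Qed.

Lemma flow_orientation_g u v : o u v -> g u v.
Proof.
case/orP=> [fuv|/andP[/eqP-> /eqP->] //].
by have := f_supp u v; rewrite fuv /=; case: (g u v).
Qed.

Lemma flow_orientation_anti u v : o u v -> ~~ o v u.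
Proof.
have x12 : x1 != x2 by apply: contraTneq he => ->; rewrite g_irr.
have [e1 e2] := flow_e.
case/orP=> [fuv|/andP[/eqP-> /eqP->]]; rewrite negb_or -leqNgt leqn0.
  rewrite (f_anti fuv) eqxx /=; apply: contraTN fuv => /andP[/eqP-> /eqP->].
  by rewrite e2.
by rewrite e2 eqxx (negbTE x12) andbF.
Qed.

Lemma flow_orientation_total u v : g u v -> o u v || o v u.
Proof.
move=> guv; have := f_supp u v; rewrite guv /= /o.
case: eqP => [/set2_eqP[][-> ->]|_ /orP[->|->]] //=; rewrite ?orbT //.
  by rewrite !eqxx orbT.
by rewrite !eqxx !orbT.
Qed.

Lemma flow_orientation_of : orientation_of (edges g) o.
Proof.
split=> u v.
  move=> uv; rewrite /adj_of mem_edges // flow_orientation_g // andbT.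
  by apply: contraTneq (flow_orientation_g uv) => ->; rewrite g_irr.
rewrite /adj_of mem_edges // => /andP[_ /flow_orientation_total].
have := @flow_orientation_anti u v; have := @flow_orientation_anti v u.
by case: (o u v) (o v u) => -[] // H1 H2 _; have := H2 isT.
Qed.

(* An arc that is not deletable is the only arc leaving some X; its value is
   then the total value entering X. *)
Lemma deletable_of_cuts a1 a2 : o a1 a2 ->
  (forall X : {set T}, a1 \in X -> a2 \notin X ->
     (forall u v, u \in X -> v \notin X -> o u v -> u = a1 /\ v = a2) ->
     3 <= #|cut g X| ->
     \sum_(p | (p.1 \in X) && (p.2 \notin X)) f p.2 p.1 <= f a1 a2 ->
     #|cut g X| <= 1 + (x2 \in X) && (x1 \notin X) + f a1 a2 ->
     False) ->
  deletable g o [set a1; a2].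
Proof.
move=> oa H; split.
  have [oE oX] := flow_orientation_of; split=> u v.
    by case/andP=> /oE; rewrite /adj_of in_setD1 => /andP[-> ->] ->.
  rewrite /adj_of in_setD1 [[set v; u]]setUC => /and3P[uv -> uvE].
  by rewrite !andbT; apply: oX; rewrite /adj_of uv.
move=> u v _; apply/negPn/negP=> /not_connect_closed[X [uX vX cl]].
have X0 : X != set0 by apply/set0Pn; exists u.
have Y0 : ~: X != set0 by apply/set0Pn; exists v; rewrite inE.
have cut3 := cut_ge3 g_sym g_irr g_cubic g_c4 X0 Y0.
have out a b : a \in X -> b \notin X -> o a b -> a = a1 /\ b = a2.
  move=> aX bX oab; have : [set a; b] = [set a1; a2].
    by apply/eqP; apply: contraNT bX => E; apply: (cl a); rewrite ?oab.
  case/set2_eqP=> // -[E1 E2]; move: oab; rewrite E1 E2 => /flow_orientation_anti.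
  by rewrite oa.
pose inn := \sum_(p | (p.1 \in X) && (p.2 \notin X)) f p.2 p.1.
pose aX := (a1 \in X) && (a2 \notin X).
have inn_le : inn <= (if aX then f a1 a2 else 0).
  rewrite /inn -balanced_cut // /aX; case: ifP => [aX'|aX'].
    rewrite (bigD1 (a1, a2)) //= big1 ?addn0 // => -[b1 b2] /= /andP[/andP[b1X b2X]].
    apply: contraNeq; rewrite -lt0n => fb.
    by have [-> ->] := out _ _ b1X b2X (introT orP (or_introl fb)).
  rewrite big1 // => -[b1 b2] /= /andP[b1X b2X].
  apply/eqP; move: aX'; apply: contraFT; rewrite -lt0n => fb.
  by have [<- <-] := out _ _ b1X b2X (introT orP (or_introl fb)); rewrite b1X.
(* A cut edge other than the arc from [a1] to [a2] must enter [X]; it then carries at least one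
   unit, unless it is the flowless edge from [x1] to [x2]. *)
have cut_le : #|cut g X| <= aX + (x2 \in X) && (x1 \notin X) + inn.
  have -> : #|cut g X| = \sum_(p | (p.1 \in X) && (p.2 \notin X)) g p.1 p.2.
    rewrite -sum1_card big_mkcond [RHS]big_mkcond.
    apply: eq_bigr => -[a b] _; rewrite inE /=.
    by case: (a \in X) (b \in X) (g a b) => -[] [].
  (* Indicators become sums over the same pairs, so that the bound can be checked term by term. *)
  have pt (b1 b2 : T) (c : bool) : (b1 \in X) && (b2 \notin X) = c -> nat_of_bool c =
     \sum_(p | (p.1 \in X) && (p.2 \notin X)) (p == (b1, b2)).
    move=> <-; have [bX|/negbTE bX] := boolP ((b1 \in X) && (b2 \notin X)).
      by rewrite (bigD1 (b1, b2)) //= eqxx big1 // => p /andP[_ /negbTE->].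
    by rewrite big1 // => -[p1 p2] /=; case: eqP => // -[-> ->]; rewrite bX.
  rewrite (pt _ _ aX erefl) (pt _ _ _ erefl) -!big_split /=; apply: leq_sum => -[p1 p2] /=.
  case/andP=> p1X p2X; case gp: (g p1 p2) => //.
  have [op|/negbTE op] := boolP (o p1 p2).
    by have [-> ->] := out _ _ p1X p2X op; rewrite eqxx.
  have := flow_orientation_total gp; rewrite op /= => /orP[fp|/andP[/eqP-> /eqP->]].
    exact: leq_trans fp (leq_addl _ _).
  by rewrite eqxx -addnA addnCA leq_addr.
(* If the arc does not leave [X], no flow enters [X] and the cut has at most one edge. *)
have [aX1|/negbTE aX1] := boolP aX; last first.
  by move: cut3 cut_le inn_le; rewrite aX1; move: inn #|_| (_ && _) => i c [] /=; lia.
rewrite aX1 in inn_le cut_le.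
case/andP: (aX1) => a1X a2X; apply: (H X) => //.
by apply: leq_trans cut_le _; rewrite leq_add2l.
Qed.

(** With flow value 0 the cut bound is at most 2, below the minimum of 3. *)
Lemma deletable_e : deletable g o [set x1; x2].
Proof.
apply: deletable_of_cuts => [|X _ _ _ c3 _]; first by rewrite /o !eqxx orbT.
by have [-> _] := flow_e; case: (_ && _); lia.
Qed.

(** The bound leaves only a cut of 3 edges with the flowless edge entering [X]. One side is then a
    single vertex: if it is [X], then [a1 = x2]; if it is the complement, then [a2 = x1]. *)
Lemma deletable_value1 a1 a2 : f a1 a2 = 1 -> a1 != x2 -> a2 != x1 ->
  deletable g o [set a1; a2].
Proof.
move=> f1 ax2 ax1; apply: deletable_of_cuts => [|X a1X a2X _ c3 _]; first by rewrite /o f1.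
rewrite f1; case: andP => [[x2X x1X] c3'|_]; last by lia.
have X0 : X != set0 by apply/set0Pn; exists a1.
have Y0 : ~: X != set0 by apply/set0Pn; exists a2; rewrite inE.
case: (cut3_singleton g_sym g_irr g_cubic g_c4 X0 Y0); first by lia.
  by case=> v E; move: ax2; rewrite E !inE in a1X x2X; rewrite (eqP a1X) (eqP x2X) eqxx.
case=> v E; have : x1 \in ~: X by rewrite inE.
have : a2 \in ~: X by rewrite inE.
by rewrite E !inE => /eqP a2v /eqP x1v; rewrite a2v x1v eqxx in ax1.
Qed.

(** Since [x1] is inside [X] or [x2] outside, the flowless edge does not enter; the cut has 3 edges
    and one side is a single end of the arc. If that end is the given [x1] or [x2], the flowless
    edge is a second arc leaving [X]; if it is the other end, an edge of value at least 3 must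
    enter, against a total of at most 2. *)
Lemma deletable_value2 a1 a2 : f a1 a2 = 2 ->
  (a1 = x1 /\ exists2 z, z != a1 & 3 <= f a2 z + f z a2) \/
  (a2 = x2 /\ exists2 z, z != a2 & 3 <= f a1 z + f z a1) ->
  deletable g o [set a1; a2].
Proof.
move=> f2 H; have [e1 e2] := flow_e; apply: deletable_of_cuts; first by rewrite /o f2.
move=> X a1X a2X out c3; rewrite f2 => inn.
have -> : (x2 \in X) && (x1 \notin X) = false.
  by case: H => -[<-] _; rewrite ?a1X ?(negbTE a2X) ?andbF.
move=> c3'.
have X0 : X != set0 by apply/set0Pn; exists a1.
have Y0 : ~: X != set0 by apply/set0Pn; exists a2; rewrite inE.
have big_arc p1 p2 : p1 \in X -> p2 \notin X -> (p1, p2) != (a1, a2) ->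
    3 <= f p1 p2 + f p2 p1 -> False.
  move=> p1X p2X pa fp.
  have f0 : f p1 p2 = 0.
    apply/eqP; apply: contraNT pa; rewrite -lt0n => fp0.
    by have [-> ->] := out _ _ p1X p2X (introT orP (or_introl fp0)).
  move: inn; rewrite (bigD1 (p1, p2)) ?p1X //=; lia.
have not_e p1 p2 : p1 \in X -> p2 \notin X -> p1 = x1 -> p2 = x2 -> False.
  move=> p1X p2X E1 E2; have : o p1 p2 by rewrite /o E1 E2 !eqxx orbT.
  by case/(out _ _ p1X p2X)=> E3 E4; move: f2; rewrite -E3 -E4 E1 E2 e1.
case: (cut3_singleton g_sym g_irr g_cubic g_c4 X0 Y0); first by lia.
  case=> v E; have vE : a1 = v by apply/eqP; move: a1X; rewrite E inE.
  case: H => -[aE [z za fz]].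
    apply: (not_e a1 x2) => //; rewrite E inE -vE aE.
    by apply: contraTneq he => ->; rewrite g_irr.
  have zv : z != v.
    apply: contraTneq fz => ->; rewrite -vE -leqNgt.
    by have := f_supp a1 a1; rewrite g_irr /=; lia.
  apply: (big_arc a1 z) => //; first by rewrite E inE.
  by rewrite xpair_eqE negb_and za orbT.
case=> v E; have XE w : (w \in X) = (w != v).
  by have /setP/(_ w) := E; rewrite !inE => <-; rewrite negbK.
have vE : a2 = v by apply/eqP; move: a2X; rewrite XE negbK.
case: H => -[aE [z za fz]]; last first.
  apply: (not_e x1 a2) => //; rewrite XE -vE aE.
  by apply: contraTneq he => ->; rewrite g_irr.
have zv : z != v.
  apply: contraTneq fz => ->; rewrite -vE -leqNgt.
  by have := f_supp a2 a2; rewrite g_irr /=; lia.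
apply: (big_arc z a2) => //; rewrite ?XE //; last by rewrite addnC.
by rewrite xpair_eqE negb_and za.
Qed.

End DeletableArcs.

(** * The maximum matching *)

(* Indexing each cycle of s from a chosen root, the vertices of odd index
   alternate with the others, except that around an odd cycle the root and its
   predecessor both have even index. *)
Lemma alternate (T : finType) (s : T -> T) (x1 x2 : T) : injective s ->
  ~~ fconnect s x1 x2 -> odd (order s x1) -> odd (order s x2) ->
  (forall v, ~~ fconnect s x1 v -> ~~ fconnect s x2 v -> ~~ odd (order s v)) ->
  exists c : pred T,
    [/\ ~~ c x1, ~~ c x2, (forall v, c v -> [/\ ~~ c (s v), s v != x1 & s v != x2]) &
        forall v, ~~ c v -> [|| c (s v), s v == x1 | s v == x2]].
Proof.
move=> sI x12 o1 o2 oth.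
(* The two odd cycles are rooted at [x1] and [x2], every other cycle at its canonical root. *)
pose r v := if fconnect s x1 v then x1 else if fconnect s x2 v then x2 else froot s v.
have csym := fconnect_sym sI.
have rv v : fconnect s (r v) v.
  rewrite /r; case: ifP => // _; case: ifP => // _.
  by rewrite csym connect_root.
have fs v w : fconnect s v (s w) = fconnect s v w.
  by rewrite !(csym v) -same_fconnect1.
have rs v : r (s v) = r v.
  rewrite /r !fs; do 2![case: ifP => // _]; apply/eqP; rewrite root_connect //.
  by rewrite csym fconnect1.
have odd_r v : odd (order s (r v)) = (r v == x1) || (r v == x2).
  apply/idP/idP=> [|/orP[]/eqP-> //].
  rewrite /r; case: ifP => [|n1]; rewrite ?eqxx //; case: ifP => [|n2]; rewrite ?eqxx ?orbT //.
  have rE x : fconnect s x (froot s v) = fconnect s x v.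
    exact/esym/(same_connect_r csym)/connect_root.
  by move=> o; move: (oth (froot s v)); rewrite !rE n1 n2 o => /(_ isT isT).
have r1 : r x1 = x1 by rewrite /r connect0.
have r2 : r x2 = x2 by rewrite /r connect0 (negbTE x12).
pose ix v := findex s (r v) v.
have ixlt v : ix v < order s (r v) by apply: findex_max.
have ixK v : iter (ix v) s (r v) = v by apply: iter_findex.
have ix1 : ix x1 = 0 by rewrite /ix r1 findex0.
have ix2 : ix x2 = 0 by rewrite /ix r2 findex0.
have ixs v : ix (s v) = if (ix v).+1 == order s (r v) then 0 else (ix v).+1.
  rewrite -[LHS]/(findex s (r (s v)) (s v)) rs.
  have -> : s v = iter (ix v).+1 s (r v) by rewrite iterS ixK.
  case: eqP => [->|ne]; first by rewrite iter_order // findex0.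
  by rewrite findex_iter //; have := ixlt v; lia.
have last_r v : (ix v).+1 = order s (r v) -> s v = r v.
  by move=> E; rewrite -{1}(ixK v) -iterS E iter_order.
have svx v x : s v = x -> r x = x -> (ix v).+1 = order s (r v) /\ r v = x.
  move=> E rx; split; last by rewrite -rs E.
  have := ixs v; rewrite E {1}/ix rx findex0; by case: eqP.
exists (fun v => odd (ix v)); rewrite ix1 ix2; split=> // v.
  move=> ov; have nx x : r x = x -> odd (order s x) -> s v != x.
    move=> rx ox; apply/eqP=> /svx/(_ rx)[E rvx].
    by move: ox; rewrite -rvx -E /= ov.
  by rewrite !nx // ixs; split=> //; case: eqP => //=; rewrite ov.
(* The last index on a cycle is its order minus one; it is even only on the cycles of [x1] and [x2],
   where the successor is that root. *)
move=> ov; rewrite ixs; case: eqP => [E|_]; last by rewrite /= ov.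
by rewrite (last_r _ E) -odd_r -E /= ov.
Qed.

Lemma matching_cover (T : finType) (S M : {set {set T}}) :
  matching_in S M -> (forall f, f \in S -> #|f| = 2) -> #|cover M| = #|M|.*2.
Proof.
case=> sM dM S2; have /eqP <- : trivIset M.
  by apply/trivIsetP => A B; apply: dM.
rewrite (eq_bigr (fun=> 2)) ?sum_nat_const ?muln2 // => f fM.
by apply/S2/(subsetP sM).
Qed.

Section PerfectMatching.
Variables (T : finType) (g : rel T) (C : {set {set T}}) (D : rel T) (x1 x2 : T).
Hypotheses (g_irr : irreflexive g) (hC : two_factor g C).
Hypothesis circC : circuit_edges C = C.
Hypothesis smoothD : smooth_orientation_circuits C D.

Lemma two_factor_edge f : f \in C -> exists u, exists2 v, u != v & f = [set u; v].
Proof.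
move/(subsetP (proj1 hC)); rewrite inE => /existsP[u /existsP[v /andP[guv /eqP->]]].
by exists u, v => //; apply: contraTneq guv => ->; rewrite g_irr.
Qed.

(** One outgoing arc at each vertex defines [s], and one incoming arc makes it injective. Orbits of
    an injection are symmetric, so edges of [C] may also be followed backwards. *)
Lemma two_factor_successor : exists s : T -> T,
  [/\ injective s, forall v w, D v w = (w == s v) &
      forall v w, fconnect s v w = (w \in component C v)].
Proof.
have [[DE Dor] Dd] := smoothD; rewrite circC in DE Dor Dd.
have Cv v : exists2 f, f \in C & v \in f.
  have : 0 < #|[set f in C | v \in f]| by rewrite (proj2 hC).
  by case/card_gt0P=> f; rewrite inE => /andP[]; exists f.
have out v : exists w, [set w | D v w] = [set w].
  by have [_ /eqP/cards1P] := Dd v (Cv v).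
have inn v : exists w, [set w | D w v] = [set w].
  by have [/eqP/cards1P] := Dd v (Cv v).
(* The default is never taken, since [out] provides an arc. *)
pose s v := odflt v [pick w | D v w].
have DS v w : D v w = (w == s v).
  have [a /setP aE] := out v; rewrite /s.
  have {}aE b : D v b = (b == a) by have := aE b; rewrite !inE.
  by case: pickP => [b|/(_ a)] /=; rewrite !aE ?eqxx // => /eqP->.
have sI : injective s.
  move=> v w E; have [a /setP aE] := inn (s v).
  have := aE v; have := aE w; rewrite !inE {1}E !DS !eqxx.
  by move=> /esym/eqP-> /esym/eqP->.
exists s; split=> // v w; rewrite inE; apply/idP/idP.
  apply: connect_sub => a b /= /eqP <-; apply: connect1.
  by apply: DE; rewrite DS.
apply: connect_sub => a b ab.
have := Dor a b ab; rewrite !DS.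
case: (b =P s a) => [-> _|_]; first exact: fconnect1.
by case: (a =P s b) => // -> _; rewrite fconnect_sym // fconnect1.
Qed.

(** The arcs leaving the set [A] given by [alternate] form a matching that avoids [x1] and [x2]. As
    [s] maps the complement of [A] into [A] and these two vertices, it misses nothing else, and a
    maximum matching is at least as large. *)
Lemma maximum_matching_cover (M : {set {set T}}) :
  x2 \notin component C x1 -> odd #|component C x1| -> odd #|component C x2| ->
  (forall v, v \notin component C x1 -> v \notin component C x2 ->
     ~~ odd #|component C v|) ->
  maximum_matching_in [set f in C | (x1 \notin f) && (x2 \notin f)] M ->
  cover M = ~: [set x1; x2].
Proof.
move=> n12 o1 o2 oth [mM maxM].
have [s [sI DS sC]] := two_factor_successor.
have ordE v : order s v = #|component C v| by apply: eq_card => w; rewrite -sC.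
have [||||c [c1 c2 cP cN]] := @alternate T s x1 x2 sI; rewrite ?ordE ?sC //.
  by move=> v; rewrite !sC ordE; apply: oth.
have [[DE _] _] := smoothD; rewrite circC in DE.
have sadj v : v != s v /\ [set v; s v] \in C.
  by apply/andP/DE; rewrite DS.
pose A := [set v | c v].
pose M' := [set [set v; s v] | v in A].
have disj v w : c v -> c w -> v != w -> [disjoint [set v; s v] & [set w; s w]].
  move=> cv cw vw; have [cv' _ _] := cP v cv; have [cw' _ _] := cP w cw.
  rewrite -setI_eq0; apply/eqP/setP=> z; rewrite !inE.
  apply/negP=> /andP[/orP[]/eqP-> /orP[]/eqP E].
  - by rewrite E eqxx in vw.
  - by rewrite E (negbTE cw') in cv.
  - by rewrite E cw in cv'.
  - by rewrite (sI _ _ E) eqxx in vw.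
have cM' : #|M'| = #|A|.
  apply: card_in_imset => v w; rewrite !inE => cv cw E.
  apply/eqP; apply: contraT => vw; have := disj _ _ cv cw vw.
  by rewrite -E -setI_eq0 setIid => /eqP/setP/(_ v); rewrite !inE eqxx.
have : #|M'| <= #|M|.
  apply: maxM; split.
    apply/subsetP=> f /imsetP[v]; rewrite inE => cv ->.
    have [_ sv1 sv2] := cP v cv; have [_ svC] := sadj v.
    rewrite !inE svC !negb_or /= ![_ == s v]eq_sym sv1 sv2 !andbT.
    have vx x : ~~ c x -> x != v by apply: contraNneq => ->.
    by rewrite !vx.
  move=> f f' /imsetP[v]; rewrite inE => cv -> /imsetP[w]; rewrite inE => cw -> ne.
  by apply: disj => //; apply: contraNneq ne => ->.
have : #|~: A| <= #|A| + 2.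
  rewrite -(card_imset _ sI); have : s @: (~: A) \subset A :|: [set x1; x2].
    apply/subsetP=> w /imsetP[v]; rewrite !inE => cv ->.
    by have := cN v cv.
  move/subset_leq_card/leq_trans; apply.
  apply: leq_trans (leq_card_setU _ _) _; rewrite leq_add2l cards2.
  by case: (_ != _).
have x12 : x1 != x2 by apply: contraNneq n12 => ->; rewrite inE connect0.
have sub : cover M \subset ~: [set x1; x2].
  apply/subsetP=> v /bigcupP[f /(subsetP (proj1 mM))]; rewrite !inE => /and3P[_ f1 f2] vf.
  by apply/negP=> /orP[]/eqP E; move: f1 f2; rewrite -E vf.
move=> A1 A2; apply/eqP; rewrite eqEcard sub.
rewrite (matching_cover mM); last first.
  move=> f; rewrite inE => /andP[/two_factor_edge[u [v uv ->]] _].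
  by rewrite cards2 uv.
have := cardsC [set x1; x2]; have := cardsC A; rewrite cards2 x12 cM' in A2 *.
lia.
Qed.
End PerfectMatching.

(** * One orientation does not suffice *)

Lemma connect_first (T : finType) (D : rel T) u v :
  connect D u v -> u != v -> exists w, D u w.
Proof.
case/connectP=> -[|w p] /= => [_ ->|/andP[uw _] _ _]; first by rewrite eqxx.
by exists w.
Qed.

Lemma connect_last (T : finType) (D : rel T) u v :
  connect D u v -> u != v -> exists w, D w v.
Proof.
rewrite connect_rev eq_sym => /connect_first/[apply] -[w wv].
by exists w.
Qed.

(** Three arcs meet at [x], so at most one leaves or at most one enters; deleting that edge makes
    [x] a sink or a source. *)
Lemma not_frank_good_lt2 (T : finType) (g : rel T) (x : T) k :
  symmetric g -> irreflexive g -> cubic g -> k < 2 -> ~ frank_good g k.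
Proof.
move=> g_sym g_irr g_cubic k2 [os [or del]].
have xg u : g x u -> x != u by apply: contraTneq => <-; rewrite g_irr.
have [o [[oE oX] {}del]] : exists o, orientation_of (edges g) o /\
    forall e, e \in edges g -> deletable g o e.
  case: k k2 os or del => [|[|//]] _ os or del.
    have /card_gt0P[u] : 0 < #|[set u | g x u]| by rewrite g_cubic.
    by rewrite inE -mem_edges // => /del[[]].
  by exists (os ord0); split=> // e /del[i]; rewrite ord1.
have deg : #|[set w | o x w]| + #|[set w | o w x]| = 3.
  have -> : #|[set w | o w x]| = #|[set w | g x w] :\: [set w | o x w]|.
    apply: eq_card => w; rewrite !inE.
    apply/idP/andP=> [owx|[nxw gxw]].
      have := oE _ _ owx; rewrite /adj_of mem_edges // => /andP[wx gwx].
      have := oX w x; rewrite /adj_of wx mem_edges // gwx owx => /(_ isT).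
      by rewrite g_sym gwx; case: (o x w).
    have := oX x w; rewrite /adj_of xg // mem_edges // gxw (negbTE nxw) => /(_ isT).
    by case: (o w x).
  rewrite -[in RHS](g_cubic x) -(cardsID [set w | o x w] [set w | g x w]); congr (_ + _).
  apply: eq_card => w; rewrite !inE; case oxw: (o x w); rewrite ?andbF //.
  by have := oE _ _ oxw; rewrite /adj_of mem_edges // andbT => /andP[].
(* If [A] is empty, any neighbour serves: [x] is then a sink or a source already. *)
have pick1 (A : {set T}) : A \subset [set w | g x w] -> #|A| <= 1 ->
    exists2 a, g x a & A \subset [set a].
  move=> Ag A1; have [A0|[a aA]] := set_0Vmem A.
    have /card_gt0P[a] : 0 < #|[set u | g x u]| by rewrite g_cubic.
    by rewrite inE => xa; exists a; rewrite // A0 sub0set.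
  exists a; first by have := subsetP Ag a aA; rewrite inE.
  by apply/subsetP=> b bA; rewrite inE; apply/eqP; apply: (card_le1_eqP A1).
have [o1|i1] : #|[set w | o x w]| <= 1 \/ #|[set w | o w x]| <= 1 by lia.
  have [|a xa /subsetP sub] := pick1 _ _ o1.
    by apply/subsetP=> w; rewrite !inE => /oE; rewrite /adj_of mem_edges // => /andP[].
  have [|_ str] := del [set x; a]; first by rewrite mem_edges.
  have [w /andP[oxw]] := connect_first (str _ _ (xg _ xa)) (xg _ xa).
  by have := sub w; rewrite !inE => /(_ oxw)/eqP->; rewrite eqxx.
have [|a xa /subsetP sub] := pick1 _ _ i1.
  by apply/subsetP=> w; rewrite !inE => /oE; rewrite /adj_of mem_edges // g_sym => /andP[].
have [|_ str] := del [set x; a]; first by rewrite mem_edges.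
have ax : a != x by rewrite eq_sym xg.
have [w /andP[owx]] := connect_last (str _ _ ax) ax.
by have := sub w; rewrite !inE => /(_ owx)/eqP->; rewrite setUC eqxx.
Qed.

(** * Smooth orientations as circulations *)

Lemma smooth_balanced (T : finType) (S : {set {set T}}) (D : rel T) :
  smooth_orientation_circuits S D -> balanced (fun u v => D u v).
Proof.
case=> -[DE _] deg v.
have sumE (P : pred T) : \sum_w (P w : nat) = #|[set w | P w]|.
  by rewrite -sum1dep_card [RHS]big_mkcond; apply: eq_bigr => w _; case: (P w).
rewrite !sumE; have [/existsP[f /andP[fS vf]]|/existsPn nv] := boolP [exists f in circuit_edges S, v \in f].
  by have [|-> ->] := deg v; first by exists f.
(* [D] orients circuit edges only, so a vertex on no circuit has no arcs. *)
rewrite !(@eq_card0 _ (mem [set _ | _])) // => w; rewrite !inE; apply/negP=> /DE /andP[_ H].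
  by have := nv [set w; v]; rewrite H set22.
by have := nv [set v; w]; rewrite H set21.
Qed.

Lemma balanced_linear (T : finType) (f h : T -> T -> nat) a b :
  balanced f -> balanced h -> balanced (fun u v => a * f u v + b * h u v).
Proof. by move=> bf bh v; rewrite !big_split -!big_distrr /= bf bh. Qed.

Lemma balanced_rev (T : finType) (f : T -> T -> nat) :
  balanced f -> balanced (fun u v => f v u).
Proof. by move=> bf v; rewrite bf. Qed.

Lemma orientation_sum (T : finType) (S : {set {set T}}) (D : rel T) u v :
  orientation_of S D -> D u v + D v u = adj_of S u v.
Proof.
case=> DE DX; case uv: (adj_of S u v).
  by have := DX _ _ uv; case: (D u v) (D v u) => -[].
have := DE u v; have := DE v u; rewrite adj_of_sym uv.
case: (D u v) => [_ /(_ isT)//|]; by case: (D v u) => // /(_ isT).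
Qed.

Lemma mem_component_edge (T : finType) (S : {set {set T}}) v a b :
  a \in component S v -> a != b -> [set a; b] \in S -> b \in component S v.
Proof.
rewrite !inE => va ab abS; apply: connect_trans va (connect1 _).
by rewrite /adj_of ab.
Qed.

Lemma component_eq (T : finType) (S : {set {set T}}) v w :
  w \in component S v -> component S v = component S w.
Proof.
rewrite inE => vw; apply/setP=> z; rewrite !inE.
exact: (same_connect (sym_connect_sym (@adj_of_sym _ S))) vw z.
Qed.

Lemma two_factor_complement (T : finType) (g : rel T) (C : {set {set T}}) v :
  symmetric g -> irreflexive g -> cubic g -> two_factor g C ->
  #|[set f in edges g :\: C | v \in f]| = 1.
Proof.
move=> g_sym g_irr g_cubic [sC dC].
have : #|[set f in edges g | v \in f]| = 3.
  rewrite -(card_adj_of v g_irr (subxx _)) -(g_cubic v); apply: eq_card => w; rewrite !inE /adj_of mem_edges //.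
  by apply: andb_idl; apply: contraTneq => <-; rewrite g_irr.
move: (edges g) sC => E sC; rewrite -(cardsID C).
have -> : [set f in E | v \in f] :&: C = [set f in C | v \in f].
  by apply/setP=> f; rewrite !inE andbAC; congr (_ && _); exact/andb_idl/(subsetP sC).
have -> : [set f in E | v \in f] :\: C = [set f in E :\: C | v \in f].
  by apply/setP=> f; rewrite !inE andbA.
by rewrite dC => -[].
Qed.

(** * The two orientations *)

Theorem theorem3 (T : finType) (g : rel T)
  (g_sym : symmetric g) (g_irr : irreflexive g)
  (g_cubic : cubic g) (g_c4 : cyclically_k_edge_connected g 4)
  (C : {set {set T}}) (hC : two_factor g C)
  (N1 N2 : {set T}) (hN1 : circuit_of C N1) (hN2 : circuit_of C N2)
  (hN12 : N1 != N2) (oddN1 : odd #|N1|) (oddN2 : odd #|N2|)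
  (hother : forall N, circuit_of C N -> N != N1 -> N != N2 -> ~~ odd #|N|)
  (x1 x2 : T) (hx1 : x1 \in N1) (hx2 : x2 \in N2) (he : g x1 x2)
  (M : {set {set T}})
  (hM : maximum_matching_in [set f in C | (x1 \notin f) && (x2 \notin f)] M) :
  let e := [set x1; x2] in
  let F := edges g :\: C in
  let Z1 := [set f in C | [&& f \subset N1, x1 \notin f &
               [exists y, ([set x1; y] \in C) && (y \in f)]]] in
  let Z2 := [set f in C | [&& f \subset N2, x2 \notin f &
               [exists y, ([set x2; y] \in C) && (y \in f)]]] in
  (exists D1 D2 : rel T,
     [/\ smooth_orientation_circuits ((F :\ e) :|: M) D1,
         smooth_orientation_circuits C D2 &
         forall u v, [set u; v] \in Z1 :|: Z2 -> u != v -> D1 u v = D2 u v]) ->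
  frank_number_is g 2.
Proof.
move=> e F Z1 Z2 [D1 [D2 [sm1 sm2 agree]]].
split; last by move=> k k2; apply: (not_frank_good_lt2 x1 g_sym).
have sC : C \subset edges g by case: hC.
have N1E : N1 = component C x1.
  by case: hN1 hx1 => v -> /component_eq.
have N2E : N2 = component C x2.
  by case: hN2 hx2 => v -> /component_eq.
have x12 : x1 != x2 by apply: contraTneq he => ->; rewrite g_irr.
have x2N1 : x2 \notin component C x1.
  by apply: contra hN12 => /component_eq E; rewrite N1E N2E E.
have degC v : #|[set w | adj_of C v w]| = 2.
  by rewrite (card_adj_of v g_irr sC); case: hC.
have circC : circuit_edges C = C.
  apply: even_no_bridge => [f|v]; first exact: (two_factor_edge g_irr hC).
  by rewrite degC.
have covM : cover M = ~: [set x1; x2].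
  apply: (maximum_matching_cover g_irr hC circC sm2) hM => //; rewrite -?N1E -?N2E //.
  move=> v v1 v2; apply: hother; first by exists v.
    by apply: contraNneq v1 => <-; rewrite inE connect0.
  by apply: contraNneq v2 => <-; rewrite inE connect0.
have [sM dM] := proj1 hM.
have MC f : f \in M -> [/\ f \in C, x1 \notin f & x2 \notin f].
  by move/(subsetP sM); rewrite inE => /and3P.
have eC : e \notin C.
  by apply: contra x2N1 => eC; apply: mem_component_edge eC; rewrite // inE connect0.
have eE : e \in edges g by rewrite mem_edges.
(* [F] is a perfect matching, and [e] is its edge at both [x1] and [x2]. *)
have Fx f x : f \in F -> x \in f -> x \in e -> f = e.
  move=> fF xf xe; have /eqP/cards1P[h hE] := two_factor_complement x g_sym g_irr g_cubic hC.
  have : f \in [set h] by rewrite -hE in_set fF.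
  have : e \in [set h] by rewrite -hE in_set in_setD eC eE.
  by rewrite !inE => /eqP-> /eqP->.
set S1 := (F :\ e) :|: M in sm1.
(* Degrees in [S1] are 0 at [x1] and [x2], and 2 elsewhere, from one edge of [F] and one of [M];
   hence [D1] orients all of [S1]. *)
have circ1 : circuit_edges S1 = S1.
  have sS1 : S1 \subset edges g.
    apply/subsetP=> f; rewrite in_setU in_setD1 in_setD => /orP[/and3P[]//|/MC[fC _ _]].
    exact: (subsetP sC).
  apply: even_no_bridge => [f /(subsetP sS1)|v].
    rewrite inE => /existsP[u /existsP[v /andP[guv /eqP->]]].
    by exists u, v => //; apply: contraTneq guv => ->; rewrite g_irr.
  rewrite (card_adj_of v g_irr sS1).
  have -> : [set f in S1 | v \in f] = [set f in F :\ e | v \in f] :|: [set f in M | v \in f].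
    by apply/setP=> f; rewrite !in_set andb_orl.
  have [ve|ve] := boolP (v \in e).
    suff -> : [set f in F :\ e | v \in f] :|: [set f in M | v \in f] = set0 by rewrite cards0.
    apply/setP=> f; rewrite in_set0; apply/negP=> /setUP[]/setIdP[].
      by case/setD1P=> /eqP ne fF vf; case: ne; apply: Fx ve.
    by move=> /MC[_ f1 f2] vf; case/set2P: ve => E; move: f1 f2; rewrite -E vf.
  have FE : [set f in F :\ e | v \in f] = [set f in F | v \in f].
    apply/setP=> f; apply/setIdP/setIdP=> -[]; first by case/setD1P.
    move=> fF vf; split=> //; rewrite in_setD1 fF andbT.
    by apply: contraNneq ve => <-.
  rewrite FE cardsU (two_factor_complement v g_sym g_irr g_cubic hC).
  have -> : [set f in F | v \in f] :&: [set f in M | v \in f] = set0.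
    apply/setP=> f; rewrite in_set0; apply/negP=> /setIP[/setIdP[/setDP[_ fC] _]].
    by case/setIdP=> /MC[fC' _ _] _; rewrite fC' in fC.
  have : v \in cover M by rewrite covM in_setC.
  case/bigcupP=> f fM vf; have -> : [set f in M | v \in f] = [set f].
    apply/setP=> f'; rewrite !inE; apply/andP/eqP=> [[fM' vf']|->] //.
    apply/eqP; apply: contraT => /(dM _ _ fM' fM) /pred0P/(_ v).
    by rewrite /= vf vf'.
  by rewrite cards1 cards0.
have [or1 _] := sm1; have [or2 _] := sm2; rewrite circ1 in or1; rewrite circC in or2.
have sum1 u v := orientation_sum u v or1.
have sum2 u v := orientation_sum u v or2.
have adjE u v : adj_of S1 u v || adj_of C u v = g u v && ([set u; v] != e).
  rewrite /adj_of -andb_orr /S1 in_setU in_setD1 in_setD (mem_edges g_sym).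
  have uvM : [set u; v] \in M -> [set u; v] \in C by case/MC.
  have [guv|ng] := boolP (g u v); last first.
    have /negbTE uvC : [set u; v] \notin C.
      by apply: contra ng => /(subsetP sC); rewrite mem_edges.
    by move: uvM; rewrite uvC => /contraFF->; rewrite ?andbF.
  have -> /= : u != v by apply: contraTneq guv => ->; rewrite g_irr.
  have [uvC|uvC] := boolP ([set u; v] \in C).
    by rewrite orbT; apply/esym; apply: contraNneq eC => <-.
  by rewrite (negbTE (contra uvM uvC)) !orbF /= andbT.
have S1x u v : adj_of S1 u v -> [/\ u != x1, u != x2, v != x1 & v != x2].
  rewrite /adj_of => /andP[_ uvS].
  suff nx x : x \in e -> (u != x) /\ (v != x).
    by have [-> ->] := nx x1 (set21 _ _); have [-> ->] := nx x2 (set22 _ _).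
  move=> xe; apply/andP; rewrite -negb_or; apply/negP=> uvx.
  have xuv : x \in [set u; v] by rewrite !inE ![x == _]eq_sym.
  move: uvS; rewrite in_setU in_setD1 => /orP[/andP[/eqP ne uvF]|/MC[_ n1 n2]].
    by case: ne; apply: Fx xe.
  by case/set2P: xe xuv n1 n2 => -> ->.
(* Under [net], reversing [D2] amounts to subtracting it. The values of [net w1] and [net w2] are 1
   and 2 on [F] without [e], and 2 and 1 on [C] outside [M]; on [M] they are 3 and 1 where [D1] and
   [D2] agree, 1 and 3 where they differ. *)
pose w1 u v := 1 * D1 u v + 2 * D2 u v.
pose w2 u v := 2 * D1 u v + 1 * D2 v u.
have b1 := smooth_balanced sm1; have b2 := smooth_balanced sm2.
have bf1 : balanced (net w1) by apply/balanced_net/balanced_linear.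
have bf2 : balanced (net w2) by apply/balanced_net/balanced_linear => //; apply: balanced_rev.
have anti (w : T -> T -> nat) u v : 0 < net w u v -> net w v u = 0.
  by rewrite /net subn_gt0 => /ltnW; rewrite -subn_eq0 => /eqP.
have supp1 u v : (0 < net w1 u v) || (0 < net w1 v u) = g u v && ([set u; v] != e).
  rewrite -adjE; have := sum1 u v; have := sum2 u v; rewrite /net /w1.
  by case: (D1 u v) (D1 v u) (D2 u v) (D2 v u) => -[] [] [];
     case: (adj_of S1 u v) (adj_of C u v) => -[].
have supp2 u v : (0 < net w2 u v) || (0 < net w2 v u) = g u v && ([set u; v] != e).
  rewrite -adjE; have := sum1 u v; have := sum2 u v; rewrite /net /w2.
  by case: (D1 u v) (D1 v u) (D2 u v) (D2 v u) => -[] [] [];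
     case: (adj_of S1 u v) (adj_of C u v) => -[].
(* As [e] is not in [C], [p] is not in [e], so an edge of [M] covers it. That edge lies in [Z1] or
   [Z2], where [D1] and [D2] agree, and has value 1 + 2. *)
have partner x p : x \in e -> [set x; p] \in C -> x != p ->
    exists2 z, z != x & 3 <= net w1 p z + net w1 z p.
  move=> xe xpC xp.
  have pe : p \notin e.
    apply: contra eC => pe; suff -> : e = [set x; p] by [].
    move: xp; case/set2P: xe => ->; case/set2P: pe => ->; rewrite ?eqxx //.
    by rewrite setUC.
  have : p \in cover M by rewrite covM in_setC.
  case/bigcupP=> f fM pf; have [fC f1 f2] := MC f fM.
  have xf : x \notin f by case/set2P: xe => ->.
  have [z pz fE] : exists2 z, p != z & f = [set p; z].
    have [a [b ab E]] := two_factor_edge g_irr hC fC.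
    move: pf; rewrite E !inE => /orP[]/eqP ->; first by exists b.
    by exists a; rewrite 1?eq_sym // setUC.
  have fN : f \subset component C x.
    have px : p \in component C x by apply: mem_component_edge xpC; rewrite // inE connect0.
    apply/subsetP=> y; rewrite fE !inE => /orP[]/eqP->; first by move: px; rewrite inE.
    have : z \in component C x by apply: mem_component_edge px pz _; rewrite -fE.
    by rewrite inE.
  have fZ : f \in Z1 :|: Z2.
    have y0 : [exists y, ([set x; y] \in C) && (y \in f)] by apply/existsP; exists p; rewrite xpC.
    have xE : x = x1 \/ x = x2 by apply/set2P.
    move: fN xf y0; rewrite in_setU !in_set fC N1E N2E.
    by case: xE => -> -> -> ->; rewrite ?orbT.
  exists z; first by apply: contraNneq xf => <-; rewrite fE set22.
  have E1 : D1 p z = D2 p z by apply: agree; rewrite -?fE.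
  have E2 : D1 z p = D2 z p by apply: agree; rewrite 1?eq_sym // setUC -fE.
  have := sum2 p z; rewrite /adj_of pz -fE fC /= /net /w1 E1 E2.
  by case: (D2 p z) (D2 z p) => -[].
pose o1 := flow_orientation x1 x2 (net w1).
pose o2 := flow_orientation x1 x2 (net w2).
have val1_1 := deletable_value1 g_sym g_irr g_cubic g_c4 he bf1 (anti w1) supp1.
have val1_2 := deletable_value1 g_sym g_irr g_cubic g_c4 he bf2 (anti w2) supp2.
have val2_1 := deletable_value2 g_sym g_irr g_cubic g_c4 he bf1 (anti w1) supp1.
suff del f : f \in edges g -> deletable g o1 f \/ deletable g o2 f.
  exists (fun i : 'I_2 => if i == ord0 then o1 else o2); split=> [i|f /del[d1|d2]].
  - case: ifP => _; first exact: (flow_orientation_of g_sym g_irr he (anti w1) supp1).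
    exact: (flow_orientation_of g_sym g_irr he (anti w2) supp2).
  - by exists ord0.
  - by exists ord_max.
rewrite inE => /existsP[u /existsP[v /andP[guv /eqP->]]].
have [->|ne] := eqVneq [set u; v] e.
  by left; apply: (deletable_e g_sym g_irr g_cubic g_c4 he bf1 (anti w1) supp1).
(* The ends are named along the second flow. *)
wlog f2 : u v guv ne / 0 < net w2 u v.
  move=> W; have := supp2 u v; rewrite guv ne /= => /orP[|f2]; first exact: W.
  by rewrite setUC; apply: W => //; rewrite 1?g_sym // setUC.
have := sum1 u v; have := sum2 u v.
have [S1uv|/negbTE S1n] := boolP (adj_of S1 u v); last first.
  have Cuv : adj_of C u v by have := adjE u v; rewrite S1n guv ne.
  rewrite Cuv => s2 s1.
  (* Only [D2] contributes here, with opposite signs in the two flows, so the arc is reversed in the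
     first. *)
  have f2E : net w2 u v = 1.
    by move: f2 s1 s2; rewrite /net /w2; case: (D1 u v) (D1 v u) (D2 u v) (D2 v u) => -[] [] [].
  have f1E : net w1 v u = 2.
    by move: f2 s1 s2; rewrite /net /w1 /w2; case: (D1 u v) (D1 v u) (D2 u v) (D2 v u) => -[] [] [].
  case/andP: Cuv => uv uvC.
  (* In these two cases [deletable_value1] fails for the second flow; the reversed arc starts at
     [x1] or ends at [x2], and [partner] gives the heavy edge at its other end. *)
  have [Ev|vx1] := eqVneq v x1.
    left; rewrite setUC; apply: val2_1 => //; left; split=> //.
    by apply: partner; rewrite ?Ev ?set21 // -?Ev 1?eq_sym // setUC.
  have [Eu|ux2] := eqVneq u x2.
    left; rewrite setUC; apply: val2_1 => //; right; split=> //.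
    by apply: partner; rewrite ?Eu ?set22 // -?Eu.
  by right; apply: val1_2.
(* [S1] avoids both ends of [e], so value 1 in either flow is enough. *)
have [ux1 ux2 vx1 vx2] := S1x u v S1uv => s2 s1.
have [f1E|f1E|f2E] : [\/ net w1 u v = 1, net w1 v u = 1 | net w2 u v = 1].
  move: f2 s1 s2; rewrite /net /w1 /w2.
  case: (D1 u v) (D1 v u) (D2 u v) (D2 v u) => -[] [] [] //=;
    by [constructor 1|constructor 2|constructor 3|case: (adj_of C u v)].
- by left; apply: val1_1.
- by left; rewrite setUC; apply: val1_1.
- by right; apply: val1_2.
Qed.
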